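(* As $n\to\infty$, the sequence of probability density functions $x\mapsto\sqrt n\,\Psi_n(\sqrt n\,x)^2$ on $\mathbb{R}$ converges weakly to the arcsine density on $[-2,2]$, $$\rho_{\mathrm{arcsine}}(x)=\begin{cases}\dfrac{1}{\pi\sqrt{4-x^2}}, & |x|<2,\\[2mm] 0,& |x|\ge 2,\end{cases}$$ that is, the probability measures with densities $\sqrt n\,\Psi_n(\sqrt n\,x)^2$ converge weakly to the probability measure with density $\rho_{\mathrm{arcsine}}$.
   Context: $He_n(x)=\mathbb{E}_{Z\sim\mathcal{N}(0,1)}[(x+\imath Z)^n]$ ($\imath=\sqrt{-1}$) is the probabilist's Hermite polynomial, and the normalized oscillator wave functions are $$\Psi_n(x)=\frac{1}{\sqrt{n!}}\,He_n(x)\,\sqrt{\frac{1}{\sqrt{2\pi}}e^{-\frac12x^2}}.$$ They satisfy $\int_{\mathbb{R}}\Psi_n(x)^2\,dx=1$. *)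

(* Defs.v *)
From HB Require Import structures.
From mathcomp Require Import all_boot all_order all_algebra.
From mathcomp Require Import complex.
From mathcomp Require Import all_classical all_reals all_analysis.
From mathcomp Require Import measurable_realfun.

Set Implicit Arguments.
Unset Strict Implicit.
Unset Printing Implicit Defensive.

Import Order.TTheory GRing.Theory Num.Theory.
Import numFieldNormedType.Exports.

Local Open Scope classical_set_scope.
Local Open Scope ring_scope.
Local Open Scope complex_scope.

Section hermite.
Context {R : realType}.

(* The library's integral is real-valued, so the expectation of a
   complex-valued function is taken componentwise. *)
Definition cexpectation (P : probability (measurableTypeR R) R) (f : R -> R[i])
    : R[i] :=
  (\int[P]_z complex.Re (f z)) +i* (\int[P]_z complex.Im (f z)).

Definition hermiteC (n : nat) (x : R) : R[i] :=
  cexpectation (normal_prob 0 1) (fun z => (x +i* z) ^+ n).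

(* No information is lost: [hermiteC n x] is real, see [hermiteCE] below. *)
Definition hermite (n : nat) (x : R) : R := complex.Re (hermiteC n x).

Definition oscillator (n : nat) (x : R) : R :=
  (Num.sqrt n`!%:R)^-1 * hermite n x *
  Num.sqrt ((Num.sqrt (2 * pi))^-1 * expR (- (2^-1 * x ^+ 2))).

Definition oscillator_density (n : nat) (x : R) : R :=
  Num.sqrt n%:R * oscillator n (Num.sqrt n%:R * x) ^+ 2.

Definition arcsine_density (x : R) : R :=
  if `|x| < 2 then (pi * Num.sqrt (4 - x ^+ 2))^-1 else 0.

End hermite.

Section hermite_real.
Context {R : realType}.

Let P : probability (measurableTypeR R) R := normal_prob (0 : R) 1.

Let measurable_Re_Im_expr n (x : R) :
  measurable_fun [set: measurableTypeR R]
    (fun z : R => complex.Re ((x +i* z) ^+ n)) /\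
  measurable_fun [set: measurableTypeR R]
    (fun z : R => complex.Im ((x +i* z) ^+ n)).
Proof.
elim: n => [|n [mRe mIm]].
  by split; apply: (eq_measurable_fun (cst _)) => // z _; rewrite expr0.
have E z : (x +i* z) ^+ n.+1 =
    (x * complex.Re ((x +i* z) ^+ n) - z * complex.Im ((x +i* z) ^+ n)) +i*
    (x * complex.Im ((x +i* z) ^+ n) + z * complex.Re ((x +i* z) ^+ n)).
  by rewrite exprS; case: ((x +i* z) ^+ n) => a b.
split.
  under eq_fun do rewrite E /=.
  by apply: measurable_funB; apply: measurable_funM => //; exact: measurable_id.
under eq_fun do rewrite E /=.
by apply: measurable_funD; apply: measurable_funM => //; exact: measurable_id.
Qed.

Let normal_probN (A : set (measurableTypeR R)) : measurable A ->
  pushforward P (-%R : R -> measurableTypeR R) A = P A.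
Proof.
move=> mA; rewrite /pushforward /P /= /normal_prob.
have -> : (\int[lebesgue_measure]_(x in A) (normal_pdf 0 1 x)%:E =
  \int[pushforward lebesgue_measure (-%R : R -> measurableTypeR R)]_(x in A)
    (normal_pdf 0 1 x)%:E)%E.
  by apply: eq_measure_integral => B mB _; exact/esym/lebesgue_measureN.
rewrite ge0_integral_pushforward//; last 2 first.
- by apply: measurable_funTS; apply/measurable_EFinP; exact: measurable_normal_pdf.
- by move=> y _; rewrite lee_fin normal_pdf_ge0.
apply: eq_integral => z _ /=; congr EFin.
by rewrite /normal_pdf oner_eq0 /normal_fun !subr0 sqrrN.
Qed.

Let integral_odd (g : R -> R) :
  measurable_fun [set: measurableTypeR R] g -> (forall z, g (- z) = - g z) ->
  \int[P]_z g z = 0.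
Proof.
move=> mg og; rewrite /Rintegral integralE.
have mE : measurable_fun [set: measurableTypeR R] (fun z => (g z)%:E).
  exact/measurable_EFinP.
have -> : (\int[P]_z (fun z => (g z)%:E)^\- z =
           \int[P]_z (fun z => (g z)%:E)^\+ z)%E.
  have -> : (\int[P]_z (fun z => (g z)%:E)^\+ z =
      \int[pushforward P (-%R : R -> measurableTypeR R)]_z
        (fun z => (g z)%:E)^\+ z)%E.
    by apply: eq_measure_integral => B mB _; exact/esym/normal_probN.
  rewrite ge0_integral_pushforward//; last exact: measurable_funepos.
  by apply: eq_integral => z _ /=; rewrite funeposE funenegE /= og.
by case: (X in (X - X)%E) => [r| |] //=; rewrite subrr.
Qed.

Lemma hermiteCE n (x : R) : hermiteC n x = (hermite n x)%:C.
Proof.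
rewrite /hermite /hermiteC /cexpectation /=; congr Complex.
apply: integral_odd; first exact: (measurable_Re_Im_expr n x).2.
move=> z; have -> : x +i* (- z) = (x +i* z)^* by [].
by rewrite -rmorphXn /=; case: ((x +i* z) ^+ n).
Qed.

End hermite_real.

Section probability_of_density.
Context {R : realType}.

Definition is_pdf (f : R -> R) : Prop :=
  [/\ measurable_fun [set: measurableTypeR R] f,
      forall x, 0 <= f x &
      (\int[lebesgue_measure]_x (f x)%:E = 1)%E].

Variables (f : R -> R) (pf : is_pdf f).

(* The unused proof argument lets the probability structure below be inferred
   from the term. *)
Definition pdf_prob (_ : is_pdf f) : set (measurableTypeR R) -> \bar R :=
  fun A => (\int[lebesgue_measure]_(x in A) (f x)%:E)%E.

Let pdf_prob0 : pdf_prob pf set0 = 0%E.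
Proof. exact: integral_set0. Qed.

Let pdf_prob_ge0 A : (0 <= pdf_prob pf A)%E.
Proof. by apply: integral_ge0 => x _; rewrite lee_fin; have [] := pf. Qed.

Let pdf_prob_sigma_additive : semi_sigma_additive (pdf_prob pf).
Proof.
have [mf f0 _] := pf; apply: semi_sigma_additive_nng_induced => //.
exact/measurable_EFinP.
Qed.

HB.instance Definition _ := isMeasure.Build _ _ _
  (pdf_prob pf) pdf_prob0 pdf_prob_ge0 pdf_prob_sigma_additive.

Let pdf_prob_setT : pdf_prob pf [set: _] = 1%E.
Proof. by have [] := pf. Qed.

HB.instance Definition _ :=
  @Measure_isProbability.Build _ _ R (pdf_prob pf) pdf_prob_setT.

End probability_of_density.

Definition weak_cvg {R : realType}
    (mu : nat -> probability (measurableTypeR R) R)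
    (nu : probability (measurableTypeR R) R) : Prop :=
  forall g : R -> R, continuous g -> [bounded g x | x in [set: R]] ->
    (\int[mu n]_x g x) @[n --> \oo] --> \int[nu]_x g x.

(* Main.v *)
Require Import Defs.
From mathcomp Require Import all_boot all_order all_algebra.
From mathcomp Require Import complex zify ring lra.
From mathcomp Require Import all_classical all_reals all_analysis.
From mathcomp Require Import measurable_realfun.

(** The proof is by the method of moments, and it never computes a moment.

    Write He_n for the Hermite polynomials, E for the expectation under the
    standard Gaussian and r = sqrt n.  The rescaled square of the n-th wave
    function integrates a polynomial p to E[p(X/r) He_n ^ 2] / n!, which is the
    case s = 0 of the matrix coefficients
      c_n(p, s) = r ^ (-s) E[p(X/r) He_n He_(n+s)] / n!,   s an integer.
    Since multiplication by X maps He_j to He_(j+1) + j He_(j-1),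
      c_n(X p, s) = c_n(p, s+1) + (n+s)/n c_n(p, s-1),
    and c_n(1, s) is 1 if s = 0 and 0 otherwise, because E[He_n He_m] is n! if
    n = m and 0 otherwise.  As n tends to infinity the weight (n+s)/n tends to 1.
    On the other side, the numbers
      a(p, s) = 1/pi * integral over [0, pi] of p(2 cos t) cos(s t) dt
    satisfy the limiting recursion exactly, by the addition formula
    2 cos t cos(s t) = cos((s+1) t) + cos((s-1) t), and have the same initial
    values.  Hence c_n(p, s) tends to a(p, s) by induction on p
    ([scaled_coef_cvg]), and a(p, 0) is the integral of p against the arcsine
    density, by the substitution x = 2 cos t ([arcsine_substitution]).

    Two tools complete the argument.  The facts on Hermite polynomials all
    follow from the Gaussian integration by parts E[X p] = E[p']
    ([gauss_by_parts]), including the identification of the expectation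
    E[(x + i Z) ^ n] with He_n(x) ([hermiteE]).  And convergence of all moments
    to those of a compactly supported law gives weak convergence
    ([weak_cvg_moments]): a bounded continuous function is within a small error
    of a polynomial on a segment, by the Weierstrass theorem
    ([polynomial_approx]), and outside that segment the error is dominated by an
    even monomial whose integral against the limit law is small. *)

Set Implicit Arguments.
Unset Strict Implicit.
Unset Printing Implicit Defensive.

Import Order.TTheory GRing.Theory Num.Theory.
Import numFieldNormedType.Exports.

Local Open Scope classical_set_scope.
Local Open Scope ring_scope.

(** * The Weierstrass approximation theorem *)

Section weierstrass.
Context {R : realType}.
Implicit Types f : R -> R.

(** The value at x is the mean of phi over the number of successes in n
    independent trials of success probability x, computed by conditioning on
    the first trial; with this form the moments below need no binomial sums. *)
Fixpoint bernstein (n : nat) (phi : nat -> R) : {poly R} :=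
  if n is m.+1 then (1 - 'X) * bernstein m phi + 'X * bernstein m (phi \o S)
  else (phi 0%N)%:P.

Lemma bernstein_le n (phi psi : nat -> R) x : 0 <= x <= 1 ->
  (forall k, (k <= n)%N -> phi k <= psi k) ->
  (bernstein n phi).[x] <= (bernstein n psi).[x].
Proof.
move=> /andP[x0 x1]; elim: n phi psi => [|n IH] phi psi le_phi /=.
  by rewrite !hornerC le_phi.
rewrite !hornerE; apply: lerD; apply: ler_wpM2l => //; rewrite ?subr_ge0//.
  by apply: IH => k kn; apply: le_phi; exact: leqW.
by apply: IH => k kn /=; apply: le_phi.
Qed.

(** The mean squared deviation of a binomial variable from c is its variance
    plus the squared distance from its mean to c. *)
Lemma bernstein_quadratic n a b c x :
  (bernstein n (fun k => a + b * (k%:R - c) ^+ 2)).[x] =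
  a + b * (n%:R * x * (1 - x) + (n%:R * x - c) ^+ 2).
Proof.
elim: n c => [|n IH] c /=; first by rewrite hornerC; ring.
have -> : (fun k => a + b * (k%:R - c) ^+ 2) \o S =
    (fun k : nat => a + b * (k%:R - (c - 1)) ^+ 2).
  by apply/funext => k /=; rewrite -natr1; congr (_ + _ * _ ^+ 2); ring.
by rewrite !hornerE !IH -natr1; ring.
Qed.

(** Heine's theorem, from the near-covering form of compactness: around each
    point one radius works for all nearby points, hence one works on the whole
    segment. *)
Lemma segment_uniformly_continuous f (a b e : R) : continuous f -> 0 < e ->
  exists2 d : R, 0 < d &
    forall x y : R, a <= x <= b -> `|x - y| < d -> `|f x - f y| < e.
Proof.
move=> cf e0.
have /compact_near_coveringP K := @segment_compact R a b.
have [] := K R (0^'+) (fun d x => forall y, `|x - y| < d -> `|f x - f y| < e).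
- move=> x _.
  have /cvgrPdist_lt /(_ _ (divr_gt0 e0 (ltr0n R 2))) := cf x.
  rewrite -nbhs_nearE => /nbhs_ballP[d /= d0 fd].
  exists (ball x (d / 2), [set t | t < d / 2]).
    split; first by apply: nbhsx_ballx; exact: divr_gt0.
    by apply: nbhs_right_lt; exact: divr_gt0.
  move=> [u t] /= [xu td] y uy; move: xu; rewrite /ball /= => xu.
  have H1 : `|f x - f u| < e / 2.
    by apply: fd; rewrite /ball /=; apply: lt_trans xu _; lra.
  have H2 : `|f x - f y| < e / 2.
    apply: fd; rewrite /ball /= (_ : x - y = (x - u) + (u - y)); last by ring.
    by apply: le_lt_trans (ler_normD _ _) _; lra.
  rewrite (_ : f u - f y = (f x - f y) - (f x - f u)); last by ring.
  by apply: le_lt_trans (ler_normB _ _) _; lra.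
- move=> d /= d0 fd; exists (d / 2); first exact: divr_gt0.
  move=> x y xab xy.
  have d2 : ball (0 : R) d (d / 2).
    by rewrite /ball /= sub0r normrN gtr0_norm ?divr_gt0//; lra.
  have d2_gt0 : 0 < d / 2 by exact: divr_gt0.
  by apply: (fd _ d2 d2_gt0 x) => //=; rewrite in_itv.
Qed.

(** By uniform continuity and boundedness, f y differs from f x by at most
    e / 2 + C (y - x) ^ 2 on [0, 1].  Averaging this quadratic bound over the
    binomial law turns (y - x) ^ 2 into the variance, which is O(1 / n). *)
Lemma bernstein_approx f (e : R) : continuous f -> 0 < e ->
  exists p : {poly R}, forall x : R, 0 <= x <= 1 -> `|f x - p.[x]| <= e.
Proof.
move=> cf e0.
have [d d0 fd] := segment_uniformly_continuous 0 1 cf (divr_gt0 e0 (ltr0n R 2)).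
have [B B0 fB] : exists2 B : R, 0 < B & forall x : R, 0 <= x <= 1 -> `|f x| <= B.
  have : compact (f @` `[0, 1]).
    apply: continuous_compact; last exact: segment_compact.
    exact: continuous_subspaceT.
  move=> /compact_bounded [B [_ HB]].
  exists (`|B| + 1); first by rewrite ltr_wpDl.
  move=> x x01; apply: (HB (`|B| + 1)); first by have := ler_norm B; lra.
  by exists x => //=; rewrite in_itv.
pose C := 2 * B / d ^+ 2.
have C0 : 0 < C by rewrite divr_gt0 ?exprn_gt0// mulr_gt0.
have fC (x y : R) : 0 <= x <= 1 -> 0 <= y <= 1 ->
    `|f y - f x| <= e / 2 + C * (y - x) ^+ 2.
  move=> x01 y01; have [xy|xy] := ltP `|x - y| d.
    rewrite distrC; apply: le_trans (ltW (fd _ _ x01 xy)) _.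
    by rewrite lerDl mulr_ge0 ?sqr_ge0 ?ltW.
  apply: le_trans (ler_normB _ _) _.
  have := fB _ x01; have := fB _ y01.
  have : 2 * B <= C * (y - x) ^+ 2.
    rewrite /C mulrAC ler_pdivlMr ?exprn_gt0// ler_wpM2l//; first by lra.
    rewrite -(real_normK (num_real (y - x))) ler_pXn2r ?nnegrE// ?(ltW d0)//.
    by rewrite distrC.
  lra.
have [n nC] : exists n : nat, C / e < n.+1%:R.
  by exists (Num.truncn (C / e)); exact: truncnS_gt.
pose phi k := f (k%:R / n.+1%:R).
exists (bernstein n.+1 phi) => x x01.
have n0 : 0 < n.+1%:R :> R by rewrite ltr0n.
have y01 k : (k <= n.+1)%N -> 0 <= (k%:R / n.+1%:R : R) <= 1.
  by move=> kn; rewrite divr_ge0//= ler_pdivrMr// mul1r ler_nat.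
have /andP[x0 x1] := x01.
have phiE k : C * (k%:R / n.+1%:R - x) ^+ 2 =
    C / n.+1%:R ^+ 2 * (k%:R - n.+1%:R * x) ^+ 2.
  by field; rewrite gt_eqF.
have bound : C / n.+1%:R ^+ 2 * (n.+1%:R * x * (1 - x) +
    (n.+1%:R * x - n.+1%:R * x) ^+ 2) <= e / 2.
  rewrite (_ : C / _ * _ = C / n.+1%:R * (x * (1 - x))); last first.
    by field; rewrite gt_eqF.
  have Ce : C / n.+1%:R <= e by rewrite ler_pdivrMr// mulrC -ler_pdivrMr// ltW.
  have xx0 : 0 <= x * (1 - x) by rewrite mulr_ge0// subr_ge0.
  have xx1 : x * (1 - x) <= 2^-1 by have := sqr_ge0 (x - 2^-1); nra.
  have C1 : 0 <= C / n.+1%:R by rewrite divr_ge0// ltW.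
  exact: ler_pM.
have up := @bernstein_le n.+1 phi
  (fun k => (f x + e / 2) + C / n.+1%:R ^+ 2 * (k%:R - n.+1%:R * x) ^+ 2)
  x x01.
have lo := @bernstein_le n.+1
  (fun k => (f x - e / 2) + - (C / n.+1%:R ^+ 2) * (k%:R - n.+1%:R * x) ^+ 2)
  phi x x01.
rewrite bernstein_quadratic in up; rewrite bernstein_quadratic in lo.
set T := C / n.+1%:R ^+ 2 * _ in bound up; rewrite mulNr -/T in lo.
have {}up : (bernstein n.+1 phi).[x] <= (f x + e / 2) + T.
  apply: up => k kn; have := fC x _ x01 (y01 k kn).
  by rewrite phiE ler_norml lerBlDl addrA => /andP[_].
have {}lo : (f x - e / 2) - T <= (bernstein n.+1 phi).[x].
  apply: lo => k kn; have := fC x _ x01 (y01 k kn).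
  by rewrite phiE ler_norml lerBrDl mulNr opprD addrA => /andP[].
by rewrite ler_norml; apply/andP; split; lra.
Qed.

Lemma polynomial_approx f (a b e : R) : continuous f -> 0 < e -> a < b ->
  exists p : {poly R}, forall x : R, a <= x <= b -> `|f x - p.[x]| <= e.
Proof.
move=> cf e0 ab.
have ba : b - a != 0 by rewrite subr_eq0 gt_eqF.
have cg : continuous (fun t => f (a + (b - a) * t)).
  move=> t; apply: continuous_comp; last exact: cf.
  by apply: cvgD; [exact: cvg_cst|apply: cvgM; [exact: cvg_cst|exact: cvg_id]].
have [p fp] := bernstein_approx cg e0.
exists (p \Po ((b - a)^-1 *: ('X - a%:P))) => x /andP[ax xb].
have -> : (p \Po ((b - a)^-1 *: ('X - a%:P))).[x] = p.[(x - a) / (b - a)].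
  by rewrite horner_comp !hornerE mulrC.
rewrite (_ : f x = f (a + (b - a) * ((x - a) / (b - a)))); last first.
  by rewrite mulrCA divff// mulr1 (addrC a) subrK.
apply: fp; apply/andP; split; first by rewrite divr_ge0 ?subr_ge0// ltW.
by rewrite ler_pdivrMr ?subr_gt0// mul1r lerB.
Qed.

End weierstrass.

(** * The method of moments *)

Section moments.
Context {R : realType}.
Implicit Types P : probability (measurableTypeR R) R.

Lemma integrable_probability_bounded P (g : R -> R) (B : R) :
  measurable_fun [set: measurableTypeR R] g -> (forall x, `|g x| <= B) ->
  P.-integrable [set: R] (EFin \o g).
Proof.
move=> mg gB; apply: measurable_bounded_integrable => //.
- by rewrite ?(le_lt_trans (probability_le1 _ _)) ?ltry.
- exists B; split => [|M BM x _]; first exact: num_real.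
  exact: le_trans (gB x) (ltW BM).
Qed.

Lemma norm_expr_double (x : R) m : `|x| ^+ m.*2 = x ^+ m.*2.
Proof. by rewrite -mul2n !exprM real_normK ?num_real. Qed.

(** Outside [- a, a] every power of x / a of degree at least that of p
    dominates p, with a constant that is the same for all these powers. *)
Lemma poly_growth (p : {poly R}) (a : R) : 0 < a ->
  exists2 C, 0 <= C & forall m (x : R), (size p <= m.*2)%N -> a <= `|x| ->
    `|p.[x]| <= C * (x / a) ^+ m.*2.
Proof.
move=> a0; exists (\sum_(i < size p) `|p`_i| * a ^+ i).
  by apply: sumr_ge0 => i _; rewrite mulr_ge0// exprn_ge0// ltW.
move=> m x pm ax; rewrite horner_coef mulr_suml.
apply: le_trans (ler_norm_sum _ _ _) _; apply: ler_sum => i _.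
rewrite normrM -mulrA ler_wpM2l// normrX.
have -> : (x / a) ^+ m.*2 = (`|x| / a) ^+ m.*2.
  by rewrite -norm_expr_double normrM normfV (gtr0_norm a0).
have xE : `|x| = a * (`|x| / a) by rewrite mulrCA divff ?mulr1// gt_eqF.
rewrite {1}xE exprMn ler_wpM2l ?exprn_ge0 ?(ltW a0)//.
apply: ler_weXn2l; first by rewrite ler_pdivlMr// mul1r.
by apply: leq_trans pm; apply: ltnW.
Qed.

(** The polynomial p and the constant C are fixed before the exponent m, so m
    can later be taken so large that the tail term has a small integral. *)
Lemma poly_approx_tail (g : R -> R) (a e : R) : continuous g ->
  [bounded g x | x in [set: R]] -> 0 < a -> 0 < e ->
  exists p : {poly R}, exists C : R, exists m0 : nat, 0 <= C /\
    forall m x, (m0 <= m)%N -> `|g x - p.[x]| <= e + C * (x / a) ^+ m.*2.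
Proof.
move=> cg [B [_ gB]] a0 e0.
have [p gp] := @polynomial_approx R g (- a) a e cg e0 (gtrN a0).
have [C C0 pC] := poly_growth p a0.
exists p, (`|B| + 1 + C), (size p); split; first by rewrite addr_ge0.
move=> m x pm; have [xa|ax] := leP `|x| a.
  rewrite ler_norml in xa; apply: le_trans (gp x xa) _.
  by rewrite lerDl mulr_ge0 ?addr_ge0// -mul2n exprM exprn_ge0// sqr_ge0.
apply: le_trans (ler_normB _ _) _; apply: ler_wpDl; first exact: ltW.
rewrite mulrDl; apply: lerD.
  have /(_ x I) /= gx : [set: R] `<=` [set x | `|g x| <= `|B| + 1].
    by move=> y _ /=; apply: gB => //; have := ler_norm B; lra.
  apply: le_trans gx _; apply: ler_peMr; first by rewrite addr_ge0.
  rewrite -norm_expr_double exprn_ege1//.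
  by rewrite normrM normfV (gtr0_norm a0) ler_pdivlMr// mul1r ltW.
by apply: pC; [rewrite (leq_trans pm)// -addnn leq_addr|exact: ltW].
Qed.

Definition poly_integrable P :=
  forall p : {poly R}, P.-integrable [set: R] (EFin \o horner p).

Lemma Rintegral_polyD P (p q : {poly R}) : poly_integrable P ->
  \int[P]_x (p + q).[x] = \int[P]_x p.[x] + \int[P]_x q.[x].
Proof.
move=> iP; rewrite -RintegralD//.
by apply: eq_Rintegral => x _; rewrite hornerD.
Qed.

Lemma Rintegral_polyZ P (c : R) (p : {poly R}) : poly_integrable P ->
  \int[P]_x (c *: p).[x] = c * \int[P]_x p.[x].
Proof.
move=> iP; rewrite -RintegralZl//.
by apply: eq_Rintegral => x _; rewrite hornerZ.
Qed.

Lemma Rintegral_polyC P (c : R) : \int[P]_x (c%:P).[x] = c.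
Proof.
under eq_Rintegral do rewrite hornerC.
rewrite Rintegral_cst//; have /= -> := @probability_setT _ _ _ P.
by rewrite mulr1.
Qed.

(** The bound on the even moments says that nu is carried by [- M, M].  A test
    function g is approximated on the larger segment [- (M + 1), M + 1] by a
    polynomial p, and then |g - p| is at most a polynomial q everywhere; the
    integrals of p and q converge, and the integral of q against nu is small
    because (M / (M + 1)) ^ (2 m) tends to 0. *)
Lemma weak_cvg_moments (mu : nat -> probability (measurableTypeR R) R)
    (nu : probability (measurableTypeR R) R) (M : R) : 0 <= M ->
  (forall n, poly_integrable (mu n)) -> poly_integrable nu ->
  (forall p : {poly R}, \int[mu n]_x p.[x] @[n --> \oo] --> \int[nu]_x p.[x]) ->
  (forall m, \int[nu]_x ('X^(m.*2)).[x] <= M ^+ m.*2) ->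
  weak_cvg mu nu.
Proof.
move=> M0 imu inu cvp nuM g cg bg.
have mg : measurable_fun [set: measurableTypeR R] g.
  exact: continuous_measurable_fun.
have ig P : P.-integrable [set: R] (EFin \o g).
  have [B [_ gB]] := bg.
  apply: (@integrable_probability_bounded _ _ (`|B| + 1)) => // x.
  by apply: gB => //; have := ler_norm B; lra.
apply/cvgrPdist_le => e e0.
have a0 : 0 < M + 1 by lra.
have e8 : 0 < e / 8 by lra.
have [p [C [m0 [C0 gp]]]] := poly_approx_tail cg bg a0 e8.
have [m [mm0 Cm]] : exists m, (m0 <= m)%N /\ C * (M / (M + 1)) ^+ m.*2 <= e / 8.
  have t0 : 0 <= M / (M + 1) by rewrite divr_ge0// ltW.
  have t1 : M / (M + 1) < 1 by rewrite ltr_pdivrMr// mul1r; lra.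
  have : `|M / (M + 1)| < 1 by rewrite ger0_norm.
  move=> /(@cvg_geometric R C) /cvgr0Pnorm_le /(_ _ e8)[N _ HN].
  exists (maxn m0 N); split; first exact: leq_maxl.
  apply: (@le_trans _ _ (C * (M / (M + 1)) ^+ maxn m0 N)).
    apply: ler_wpM2l => //; apply: ler_wiXn2l => //; first exact: ltW.
    by rewrite -addnn leq_addr.
  by apply: le_trans (ler_norm _) _; apply: HN; exact: leq_maxr.
pose c := C / (M + 1) ^+ m.*2.
have c0 : 0 <= c by rewrite divr_ge0// exprn_ge0// ltW.
pose q : {poly R} := (e / 8)%:P + c *: 'X^(m.*2).
have qE x : q.[x] = e / 8 + C * (x / (M + 1)) ^+ m.*2.
  by rewrite /q !hornerE exprMn exprVn mulrA mulrAC.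
have nuq : \int[nu]_x q.[x] <= e / 4.
  rewrite Rintegral_polyD// Rintegral_polyC Rintegral_polyZ//.
  have : c * \int[nu]_x ('X^(m.*2)).[x] <= e / 8.
    apply: le_trans Cm; rewrite exprMn exprVn mulrCA (mulrC (M ^+ _)) -/c.
    by apply: ler_wpM2l.
  by lra.
have sandwich P : poly_integrable P ->
  `|\int[P]_x g x - \int[P]_x p.[x]| <= \int[P]_x q.[x].
  move=> iP; have igp : P.-integrable [set: R] (EFin \o (fun x => g x - p.[x])).
    have := integrableB measurableT (ig P) (iP p).
    by apply: eq_integrable.
  rewrite -RintegralB//; last exact: ig.
  apply: (le_trans (le_normr_Rintegral measurableT igp)).
  apply: le_Rintegral => //.
  - by have := integrable_norm igp; apply: eq_integrable.
  - by move=> x _; rewrite qE; exact: gp.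
have := cvp p => /cvgrPdist_le /(_ _ e8) cp.
have := cvp q => /cvgrPdist_le /(_ _ e8) cq.
near=> n.
have Hp : `|\int[nu]_x p.[x] - \int[mu n]_x p.[x]| <= e / 8 by near: n.
have Hq : `|\int[nu]_x q.[x] - \int[mu n]_x q.[x]| <= e / 8 by near: n.
have := sandwich _ inu; have := sandwich _ (imu n).
move: Hp Hq; rewrite !ler_norml.
move=> /andP[? ?] /andP[? ?] /andP[? ?] /andP[? ?]; apply/andP; split; lra.
Unshelve. all: by end_near.
Qed.

End moments.

(** * Densities and changes of variables *)

Section density.
Context {R : realType}.
Local Notation mu := (@lebesgue_measure R).
Variables (P : probability (measurableTypeR R) R) (f : R -> R).
Hypotheses (mf : measurable_fun [set: measurableTypeR R] f)
  (f0 : forall x, 0 <= f x)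
  (Pf : forall A, measurable A -> P A = (\int[mu]_(x in A) (f x)%:E)%E).

(** The Radon-Nikodym derivative of P is almost everywhere f. *)
Let ge0_integral_density (g : R -> \bar R) : (forall x, 0 <= g x)%E ->
  measurable_fun [set: measurableTypeR R] g ->
  (\int[P]_x g x = \int[mu]_x (g x * (f x)%:E))%E.
Proof.
move=> g0 mg.
have mfE : measurable_fun [set: measurableTypeR R] (EFin \o f).
  exact/measurable_EFinP.
have Pmu : P `<< mu.
  apply/null_content_dominatesP => A mA muA0; rewrite Pf//.
  by apply: null_set_integral => //; exact: measurable_funTS.
have RN : ae_eq mu [set: R] (Radon_Nikodym_SigmaFinite.f P mu) (EFin \o f).
  apply: integral_ae_eq => //; first exact: Radon_Nikodym_SigmaFinite.f_integrable.
  by move=> E _ mE; rewrite -Radon_Nikodym_SigmaFinite.f_integral//; exact: Pf.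
rewrite -(Radon_Nikodym_SigmaFinite.change_of_variables Pmu)//.
apply: ae_eq_integral => //; last exact: ae_eqe_mul2l.
- apply: emeasurable_funM => //.
  exact: measurable_int (Radon_Nikodym_SigmaFinite.f_integrable Pmu).
- exact: emeasurable_funM.
Qed.

(** The nonnegative case suffices: the integral of g is by definition the
    difference of those of its positive and negative parts, and multiplication
    by the nonnegative f commutes with taking these parts. *)
Lemma integral_density (g : R -> R) : measurable_fun [set: measurableTypeR R] g ->
  (\int[P]_x (g x)%:E = \int[mu]_x (g x * f x)%:E)%E.
Proof.
move=> mg; have mgE : measurable_fun [set: measurableTypeR R] (EFin \o g).
  exact/measurable_EFinP.
rewrite integralE [RHS]integralE !ge0_integral_density//; last 2 first.
- exact: measurable_funeneg.
- exact: measurable_funepos.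
congr (_ - _)%E; apply: eq_integral => x _.
- by rewrite !funeposE maxe_pMl ?lee_fin// mul0e.
- by rewrite !funenegE maxe_pMl ?lee_fin// mul0e mulNe.
Qed.

Lemma integrable_density (g : R -> R) : measurable_fun [set: measurableTypeR R] g ->
  mu.-integrable [set: R] (fun x => (g x * f x)%:E) ->
  P.-integrable [set: R] (EFin \o g).
Proof.
move=> mg /integrableP[_ igf]; apply/integrableP.
split; first exact/measurable_EFinP.
rewrite (@integral_density (fun x => `|g x|)); last exact: measurableT_comp.
apply: le_lt_trans igf; apply: ge0_le_integral => //.
- by move=> x _; rewrite lee_fin mulr_ge0.
- by apply/measurable_EFinP; apply: measurable_funM => //; exact: measurableT_comp.
- by apply/measurableT_comp => //; apply/measurable_EFinP; exact: measurable_funM.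
- by move=> x _; rewrite /= lee_fin normrM (ger0_norm (f0 x)).
Qed.
End density.

Lemma integral_segment_cvg {R : realType} (f : R -> \bar R) :
  (@lebesgue_measure R).-integrable [set: R] f ->
  (\int[lebesgue_measure]_(x in `[(- n.+1%:R)%R, (n.+1%:R : R)%R]) f x)%E
    @[n --> \oo] --> (\int[lebesgue_measure]_x f x)%E.
Proof.
move=> fi; have mf := measurable_int _ fi.
pose I (n : nat) := `[- n.+1%:R, n.+1%:R]%classic : set R.
have mI n : measurable (I n) by exact: measurable_itv.
have mfI n : measurable_fun [set: R] (f \_ (I n)).
  by apply/(measurable_restrictT f) => //; exact: measurable_funTS.
have cvgI : {ae lebesgue_measure, forall x, [set: R] x ->
    (f \_ (I n)) x @[n --> \oo] --> f x}.
  apply: aeW => x _; apply: cvg_near_cst.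
  near=> n; rewrite patchE mem_set// /I /= in_itv /= -ler_norml.
  have : `|x| < n%:R by near: n; exact: nbhs_infty_gtr.
  by move=> /ltW /le_trans; apply; rewrite ler_nat.
have dom : {ae lebesgue_measure, forall x n, [set: R] x ->
    (`|(f \_ (I n)) x| <= `|f x|)%E}.
  by apply: aeW => x n _; rewrite patchE; case: ifP => // _; rewrite abse0.
have [_ _] := @dominated_convergence _ _ _ (@lebesgue_measure R) _
  measurableT _ _ _ mfI mf cvgI (integrable_abse fi) dom.
by under eq_fun do rewrite -integral_mkcond.
Unshelve. all: by end_near.
Qed.

Section change_of_variables.
Context {R : realType}.
Local Notation mu := (@lebesgue_measure R).

(** The positive and negative parts of a continuous function are continuous,
    so a change of variables known for nonnegative continuous functions holds
    for all of them. *)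
Lemma eq_integral_continuous (D E : set R) (w v : R -> R) (F : R -> R) :
  (forall x, 0 <= w x) -> (forall x, 0 <= v x) ->
  (forall g : R -> R, continuous g -> (forall x, 0 <= g x) ->
    (\int[mu]_(x in D) (g x * w x)%:E = \int[mu]_(x in E) (g (F x) * v x)%:E)%E) ->
  forall g : R -> R, continuous g ->
    (\int[mu]_(x in D) (g x * w x)%:E = \int[mu]_(x in E) (g (F x) * v x)%:E)%E.
Proof.
move=> w0 v0 H g cg.
have pos (S : set R) (u k : R -> R) : (forall x, 0 <= k x) ->
    (\int[mu]_(x in S) (fun y => (u y * k y)%:E)^\+ x =
     \int[mu]_(x in S) (Num.max (u x) 0 * k x)%:E)%E.
  move=> k0; apply: eq_integral => x _.
  by rewrite funeposE -EFin_max maxr_pMl// mul0r.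
have neg (S : set R) (u k : R -> R) : (forall x, 0 <= k x) ->
    (\int[mu]_(x in S) (fun y => (u y * k y)%:E)^\- x =
     \int[mu]_(x in S) (Num.max (- u x) 0 * k x)%:E)%E.
  move=> k0; apply: eq_integral => x _.
  by rewrite funenegE -EFinN -EFin_max maxr_pMl// mul0r mulNr.
have cont (u : R -> R) : continuous u -> continuous (fun x => Num.max (u x) 0).
  move=> cu x; apply: (@continuous_max _ _ u (cst 0)); first exact: cu.
  exact: cst_continuous.
rewrite integralE [RHS]integralE !pos// !neg//; congr (_ - _)%E.
  apply: (H (fun x => Num.max (g x) 0)); first exact: cont.
  by move=> x; rewrite le_max lexx orbT.
apply: (H (fun x => Num.max (- g x) 0)); last by move=> x; rewrite le_max lexx orbT.
by apply: (cont (fun x => - g x)) => x; apply: cvgN; exact: cg.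
Qed.

Lemma integral_scale (c : R) (G : R -> R) : 0 < c -> continuous G ->
  (\int[mu]_x (G (c * x) * c)%:E = \int[mu]_x (G x)%:E)%E.
Proof.
move=> c0 cG.
have H := @eq_integral_continuous setT setT (cst 1) (cst c) (fun x => c * x)
  _ _ _ G cG.
rewrite -H.
- by apply: eq_integral => x _; rewrite mulr1.
- by move=> x; exact: ler01.
- by move=> x; exact: ltW.
move=> {H} {}G {}cG G0.
have F'E : (fun x : R => c * x)^`()%classic = cst c.
  apply/funext => x; rewrite derive1E; apply: derive_val.
  by apply: is_derive_eq; rewrite /GRing.scale /= mulr1.
under eq_integral do rewrite mulr1.
rewrite (@increasing_ge0_integration_by_substitutionT R (fun x => c * x))//.
- by apply: eq_integral => x _; rewrite F'E.
- by move=> x y xy; rewrite ltr_pM2l.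
- by rewrite F'E => ?; exact: cvg_cst.
- by rewrite F'E; exact: is_cvg_cst.
- by rewrite F'E; exact: is_cvg_cst.
- by under eq_fun do rewrite mulrC; apply/gt0_cvgMlNy.
- by under eq_fun do rewrite mulrC; apply/gt0_cvgMly.
Qed.

End change_of_variables.

(** * Gaussian integrals of polynomials *)

Section gaussian.
Context {R : realType}.
Local Notation mu := (@lebesgue_measure R).
Local Notation gauss := (normal_prob (0 : R) 1).
Local Notation phi := (normal_pdf (0 : R) 1).
Local Notation psi := (normal_pdf (0 : R) (Num.sqrt 2)).

Lemma normal_pdf01E (x : R) :
  phi x = (Num.sqrt (2 * pi))^-1 * expR (- (2^-1 * x ^+ 2)).
Proof.
rewrite normal_pdfE ?oner_eq0// /normal_peak /normal_fun subr0 expr1n mul1r.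
rewrite mulr_natl; by congr (_ * expR _); rewrite mulNr mulrC.
Qed.

Lemma normal_pdf02E (x : R) :
  psi x = (Num.sqrt (4 * pi))^-1 * expR (- (4^-1 * x ^+ 2)).
Proof.
rewrite normal_pdfE ?sqrtr_eq0 -?ltNge// /normal_peak /normal_fun subr0 sqr_sqrtr//.
congr (_^-1 * expR _); last by field.
by congr Num.sqrt; rewrite -mulr_natr; ring.
Qed.

Lemma expn_le_expR i (x : R) :
  `|x| ^+ i <= (1 + 4 ^+ i * i`!%:R) * expR (4^-1 * x ^+ 2).
Proof.
set t := 4^-1 * _; have t0 : 0 <= t by rewrite mulr_ge0 ?sqr_ge0.
have e1 : 1 <= expR t by rewrite -expR0 ler_expR.
(* The term of order i of the exponential series. *)
have ti : t ^+ i <= i`!%:R * expR t.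
  case: i => [|i]; first by rewrite expr0 fact0 mul1r.
  rewrite mulrC -ler_pdivrMr ?ltr0n ?fact_gt0//.
  by apply: le_trans (expR_ge1Dxn i t0); rewrite lerDr.
have xi : `|x| ^+ i <= 1 + (x ^+ 2) ^+ i.
  rewrite -(real_normK (num_real x)) exprAC; have := sqr_ge0 (`|x| ^+ i - 2^-1).
  by rewrite sqrrB => H; nra.
apply: le_trans xi _; rewrite mulrDl mul1r; apply: lerD => //.
have x2 : x ^+ 2 = 4 * t by rewrite /t; field.
by rewrite x2 exprMn -mulrA ler_wpM2l// exprn_ge0.
Qed.

(** A Gaussian density of larger variance dominates: half of the exponent
    x ^ 2 / 2 absorbs the polynomial, the other half is the density psi of
    variance 2.  This gives both integrability and decay at infinity. *)
Lemma poly_gauss_le (p : {poly R}) :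
  exists2 C, 0 <= C & forall x, `|p.[x]| * phi x <= C * psi x.
Proof.
pose K : R := (Num.sqrt (2 * pi))^-1; pose K' : R := (Num.sqrt (4 * pi))^-1.
have K0 : 0 <= K by rewrite invr_ge0.
have K'0 : 0 < K' by rewrite invr_gt0 sqrtr_gt0 mulr_gt0 ?pi_gt0.
pose c := \sum_(i < size p) `|p`_i| * (1 + 4 ^+ i * i`!%:R).
have c0 : 0 <= c.
  by apply: sumr_ge0 => i _; rewrite mulr_ge0// addr_ge0// mulr_ge0// exprn_ge0.
exists (c * K / K'); first by rewrite divr_ge0 ?mulr_ge0// ltW.
move=> x; rewrite normal_pdf01E normal_pdf02E -/K -/K'.
rewrite (_ : - (2^-1 * x ^+ 2) = - (4^-1 * x ^+ 2) + - (4^-1 * x ^+ 2));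
  last by field.
rewrite expRD; set E := expR _; have E0 : 0 <= E by exact: expR_ge0.
have -> : c * K / K' * (K' * E) = c * (K * E) by field; rewrite gt_eqF.
rewrite (_ : `|p.[x]| * _ = `|p.[x]| * E * (K * E)); last by ring.
apply: ler_wpM2r; first by rewrite mulr_ge0.
rewrite /E expRN ler_pdivrMr ?expR_gt0// horner_coef /c mulr_suml.
apply: le_trans (ler_norm_sum _ _ _) _; apply: ler_sum => i _.
by rewrite normrM -mulrA ler_wpM2l// normrX expn_le_expR.
Qed.

Lemma measurable_poly_gauss (p : {poly R}) :
  measurable_fun [set: measurableTypeR R] (fun x => p.[x] * phi x).
Proof.
apply: measurable_funM; last exact: measurable_normal_pdf.
by apply: continuous_measurable_fun; exact: continuous_horner.
Qed.

Lemma integrable_poly_gauss (p : {poly R}) :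
  mu.-integrable [set: R] (fun x => (p.[x] * phi x)%:E).
Proof.
have [C C0 pC] := poly_gauss_le p.
have ipsi :=
  integrableZl measurableT C (integrable_normal_pdf (0 : R) (Num.sqrt 2)).
apply: le_integrable ipsi => //.
  by apply/measurable_EFinP; exact: measurable_poly_gauss.
move=> x _; rewrite /= lee_fin normrM (ger0_norm (normal_pdf_ge0 _ _ _)).
by rewrite [leRHS]ger0_norm// mulr_ge0// normal_pdf_ge0.
Qed.

Lemma poly_integrable_gauss : poly_integrable gauss.
Proof.
move=> p; apply: (@integrable_density R gauss phi) => //.
- exact: measurable_normal_pdf.
- by move=> x; exact: normal_pdf_ge0.
- by apply: continuous_measurable_fun; exact: continuous_horner.
- exact: integrable_poly_gauss.
Qed.

Lemma gauss_Rintegral (p : {poly R}) :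
  \int[gauss]_x p.[x] = \int[mu]_x (p.[x] * phi x).
Proof.
rewrite /Rintegral (@integral_density R gauss phi) //.
- exact: measurable_normal_pdf.
- by move=> x; exact: normal_pdf_ge0.
- by apply: continuous_measurable_fun; exact: continuous_horner.
Qed.

Lemma is_derive_poly_gauss (p : {poly R}) (x : R) :
  is_derive x 1 (fun y => - (p.[y] * phi y)) (('X * p - p^`()).[x] * phi x).
Proof.
have -> : (fun y => - (p.[y] * phi y)) = (fun y => - (p.[y] *
    ((Num.sqrt (2 * pi))^-1 * expR (- (2^-1 * y ^+ 2))))).
  by apply/funext => y; rewrite normal_pdf01E.
apply: trigger_derive.
rewrite normal_pdf01E !hornerE /GRing.scale /=.
set E := expR _; set K := (Num.sqrt _)^-1; lra.
Qed.

(** Apply the domination to X p: then p phi is O(1 / |x|). *)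
Lemma poly_gauss_cvg0 (p : {poly R}) (u : R^nat) : (forall n, `|u n| = n.+1%:R) ->
  p.[u n] * phi (u n) @[n --> \oo] --> (0 : R).
Proof.
move=> un; have [C C0 pC] := poly_gauss_le ('X * p).
have s0 : Num.sqrt 2 != 0 :> R by rewrite sqrtr_eq0 -ltNge.
pose B : R := C * normal_peak (Num.sqrt 2).
apply/norm_cvg0P; apply: (@squeeze_cvgr _ _ _ _ (cst 0) (fun n => B * n.+1%:R^-1)).
- near=> n; rewrite normr_ge0/= ler_pdivlMr ?ltr0n// -un -normrM.
  rewrite (_ : _ * u n = ('X * p).[u n] * phi (u n)); last first.
    by rewrite !hornerE; ring.
  rewrite normrM (ger0_norm (normal_pdf_ge0 _ _ _)); apply: le_trans (pC _) _.
  by rewrite ler_wpM2l// normal_pdf_ub.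
- exact: cvg_cst.
- rewrite -[X in _ --> X](mulr0 B); apply: cvgM; first exact: cvg_cst.
  exact: cvg_harmonic.
Unshelve. all: by end_near.
Qed.

(** Stein's identity: (X p - p') phi is the derivative of - p phi, which vanishes
    at both ends of the line. *)
Lemma gauss_by_parts (p : {poly R}) :
  \int[gauss]_x ('X * p).[x] = \int[gauss]_x (p^`()).[x].
Proof.
apply/eqP; rewrite -subr_eq0; apply/eqP.
set q := 'X * p - p^`().
have -> : \int[gauss]_x ('X * p).[x] - \int[gauss]_x (p^`()).[x] =
    \int[gauss]_x q.[x].
  rewrite -RintegralB//; [|exact: poly_integrable_gauss..].
  by apply: eq_Rintegral => x _; rewrite hornerD hornerN.
rewrite gauss_Rintegral.
pose f := fun x => q.[x] * phi x.
pose I (n : nat) := `[- n.+1%:R, n.+1%:R]%classic : set R.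
have cf : continuous f.
  move=> x; apply: cvgM; first exact: continuous_horner.
  by apply: continuous_normal_pdf; rewrite oner_eq0.
have FTC n : (\int[mu]_(x in I n) (f x)%:E)%E =
    (- (p.[n.+1%:R] * phi n.+1%:R) + p.[- n.+1%:R] * phi (- n.+1%:R))%:E.
  have dF x : derivable (fun y => - (p.[y] * phi y)) x 1.
    by have /@ex_derive := is_derive_poly_gauss p x.
  have cF : continuous (fun y => - (p.[y] * phi y)).
    by move=> x; apply/differentiable_continuous/derivable1_diffP.
  rewrite (@continuous_FTC2 _ f (fun y => - (p.[y] * phi y))).
  - by rewrite -EFinB opprK.
  - by rewrite gtrN// ltr0n.
  - exact: continuous_subspaceT.
  - split; first by move=> x _; exact: dF.
    + by apply: cvg_at_right_filter; exact: cF.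
    + by apply: cvg_at_left_filter; exact: cF.
  - move=> x _; rewrite derive1E.
    by have /@derive_val := is_derive_poly_gauss p x.
have lim0 : (- (p.[n.+1%:R] * phi n.+1%:R) + p.[- n.+1%:R] * phi (- n.+1%:R))%:E
    @[n --> \oo] --> (0 : R)%:E.
  apply/fine_cvgP; split; first by near=> n.
  have l1 := @poly_gauss_cvg0 p (fun n => n.+1%:R) (fun n => ger0_norm (ler0n _ _)).
  have l2 := @poly_gauss_cvg0 p (fun n => - n.+1%:R)
    (fun n => etrans (normrN _) (ger0_norm (ler0n _ _))).
  have := cvgD (cvgN l1) l2; rewrite oppr0 addr0; exact.
have := integral_segment_cvg (integrable_poly_gauss q).
rewrite (_ : (fun n => _) = (fun n => (- (p.[n.+1%:R] * phi n.+1%:R) +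
    p.[- n.+1%:R] * phi (- n.+1%:R))%:E)); last by apply/funext => n; exact: FTC.
by move=> /(cvg_unique _ lim0); rewrite /Rintegral => <-.
Unshelve. all: by end_near.
Qed.

End gaussian.

(** * Hermite polynomials *)

Section hermite_polynomials.
Context {R : realType}.
Local Notation gauss := (normal_prob (0 : R) 1).
Implicit Types p q : {poly R}.

Fixpoint hermite_poly (n : nat) : {poly R} :=
  if n is m.+1 then 'X * hermite_poly m - (hermite_poly m)^`() else 1.
Local Notation h := hermite_poly.

Definition gaussE p : R := \int[gauss]_x p.[x].

Lemma gaussED p q : gaussE (p + q) = gaussE p + gaussE q.
Proof. by apply: Rintegral_polyD; exact: poly_integrable_gauss. Qed.

Lemma gaussEZ c p : gaussE (c *: p) = c * gaussE p.
Proof. by apply: Rintegral_polyZ; exact: poly_integrable_gauss. Qed.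

Lemma gaussEC c : gaussE c%:P = c.
Proof. exact: Rintegral_polyC. Qed.

Lemma gaussEXM p : gaussE ('X * p) = gaussE p^`().
Proof. exact: gauss_by_parts. Qed.

Lemma gaussEN p : gaussE (- p) = - gaussE p.
Proof. by rewrite -scaleN1r gaussEZ mulN1r. Qed.

Lemma gaussEMn p n : gaussE (p *+ n) = gaussE p *+ n.
Proof. by rewrite -scaler_nat gaussEZ mulr_natl. Qed.

Lemma deriv_hermite_poly n : (h n.+1)^`() = h n *+ n.+1.
Proof.
elim: n => [|n IH].
  by rewrite /= mulr1 derivB derivX derivC deriv0 subr0 mulr1n.
rewrite [in LHS]/= -/(h n.+1) derivB derivM derivX mul1r IH derivMn.
rewrite [in RHS]mulrS -addrA; congr (_ + _).
by rewrite mulrnAr -mulrnBl.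
Qed.

(** For n = 0 the last term is 0, whatever the predecessor of 0 is. *)
Lemma mulX_hermite_poly n : 'X * h n = h n.+1 + h n.-1 *+ n.
Proof.
case: n => [|n]; first by rewrite /= derivC subr0 mulr0n addr0.
by rewrite [h n.+2]/= -/(h n.+1) deriv_hermite_poly subrK.
Qed.

(** Multiplication by X minus differentiation is the adjoint of
    differentiation for the Gaussian inner product. *)
Lemma gaussE_hermite_polyM n p : gaussE (h n.+1 * p) = gaussE (h n * p^`()).
Proof.
rewrite /= mulrBl -mulrA gaussED gaussEN gaussEXM derivM gaussED.
by rewrite [X in X - _]addrC addrK.
Qed.

Lemma hermite_poly_orthogonal n m : gaussE (h n * h m) = n`!%:R *+ (n == m).
Proof.
elim: n m => [|n IH] [|m].
- by rewrite /= mulr1 gaussEC.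
- by rewrite mulrC gaussE_hermite_polyM /= derivC mulr0 (gaussEC 0).
- by rewrite gaussE_hermite_polyM /= derivC mulr0 (gaussEC 0).
rewrite gaussE_hermite_polyM deriv_hermite_poly mulrnAr gaussEMn IH eqSS.
by case: eqP => [->|_]; rewrite ?mul0rn// factS mulnC natrM mulr_natr.
Qed.

(** Real and imaginary parts of (x + i z) ^ n as polynomials in z, with x a
    parameter, so that Gaussian integration by parts applies to them. *)
Fixpoint reim_poly (x : R) (n : nat) : {poly R} * {poly R} :=
  if n is m.+1 then
    (x *: (reim_poly x m).1 - 'X * (reim_poly x m).2,
     x *: (reim_poly x m).2 + 'X * (reim_poly x m).1)
  else (1, 0).

Lemma reim_polyE x n z : ((x +i* z) ^+ n)%C =
  ((reim_poly x n).1.[z] +i* (reim_poly x n).2.[z])%C.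
Proof.
elim: n => [|n IH]; first by rewrite expr0 /= !hornerE.
by rewrite exprS IH /= !hornerE; congr Complex; rewrite ?hornerE// mulrC.
Qed.

(** The z-derivative of (x + i z) ^ (n + 1) is i (n + 1) (x + i z) ^ n. *)
Lemma deriv_reim_poly x n :
  (reim_poly x n.+1).1^`() = - (reim_poly x n).2 *+ n.+1 /\
  (reim_poly x n.+1).2^`() = (reim_poly x n).1 *+ n.+1.
Proof.
elim: n => [|n [IH1 IH2]].
  rewrite /= !(mulr0, mulr1, scaler0, subr0, add0r) mulr1n derivX derivZ derivC.
  by rewrite scaler0 oppr0.
split; rewrite [reim_poly x n.+2]/= -/(reim_poly x n.+1).
  rewrite derivB derivZ derivM derivX IH1 IH2 /= -!mul_polyC; ring.
by rewrite derivD derivZ derivM derivX IH1 IH2 /= -!mul_polyC; ring.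
Qed.

(** Integrating by parts the term i Z in E[(x + i Z) ^ (n + 2)] gives
    x E[(x + i Z) ^ (n + 1)] - (n + 1) E[(x + i Z) ^ n], the three-term
    recursion of the Hermite polynomials. *)
Lemma hermiteE n x : hermite n x = (h n).[x].
Proof.
have -> : hermite n x = gaussE (reim_poly x n).1.
  rewrite /hermite /hermiteC /cexpectation /= /gaussE.
  by apply: eq_Rintegral => z _; rewrite reim_polyE.
have [//] : gaussE (reim_poly x n).1 = (h n).[x] /\
    gaussE (reim_poly x n.+1).1 = (h n.+1).[x].
elim: n => [|n [IH1 IH2]].
  by rewrite /= !mulr0 subr0 mulr1 derivC subr0 gaussEZ !(gaussEC 1) !hornerE.
split => //.
rewrite [reim_poly x n.+2]/= gaussED gaussEN gaussEXM gaussEZ IH2.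
rewrite (deriv_reim_poly x n).2 gaussEMn IH1.
by rewrite [h n.+2]/= -/(h n.+1) deriv_hermite_poly !hornerE hornerMn.
Qed.

End hermite_polynomials.

(** * The arcsine law *)

Section arcsine_law.
Context {R : realType}.
Local Notation mu := (@lebesgue_measure R).

Lemma arcsine_density_ge0 (x : R) : 0 <= arcsine_density x.
Proof.
by rewrite /arcsine_density; case: ifP => // _; rewrite invr_ge0 mulr_ge0// pi_ge0.
Qed.

Let F (t : R) := 2 * cos t.

Let is_derive_F (t : R) : is_derive t 1 F (- (2 * sin t)).
Proof. by apply: trigger_derive; rewrite /GRing.scale /=; ring. Qed.

(** The density is unbounded near 2 and -2, so the substitution is made on the
    angles [eps k, pi - eps k], whose union over k is ]0, pi[. *)
Let eps (k : nat) : R := pi / k.+3%:R.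

Let eps_bnd k : 0 < eps k < pi - eps k.
Proof.
rewrite divr_gt0 ?pi_gt0//= ltrBrDl -mulr2n -mulr_natl mulrA ltr_pdivrMr//.
by rewrite mulrC ltr_pM2l ?pi_gt0// ltr_nat.
Qed.

Let eps_itv k (t : R) : t \in `[eps k, pi - eps k] -> t \in `]0, pi[.
Proof.
have /andP[e0 e1] := eps_bnd k; rewrite !in_itv/= => /andP[t0 t1].
by rewrite (lt_le_trans e0 t0)/= (le_lt_trans t1)// ltrBlDr ltrDl.
Qed.

Let eps_le : {homo eps : m n / (m <= n)%N >-> n <= m}.
Proof.
by move=> m n mn; rewrite /eps ler_pM2l ?pi_gt0// lef_pV2 ?posrE// ler_nat.
Qed.

Let eps_exists (t : R) : t \in `]0, pi[ -> exists k, t \in `[eps k, pi - eps k].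
Proof.
rewrite in_itv/= => /andP[t0 tpi].
pose s := Num.min t (pi - t).
have s0 : 0 < s by rewrite lt_min t0 subr_gt0.
exists (Num.truncn (pi / s)).
have : eps (Num.truncn (pi / s)) <= s.
  rewrite /eps ler_pdivrMr// mulrC -ler_pdivrMr// ltW//.
  by apply: (lt_le_trans (truncnS_gt _)); rewrite ler_nat leqW.
by rewrite in_itv/= le_min => /andP[-> ?]/=; lra.
Qed.

Let itv_oo_cc (t : R) : t \in `]0, pi[ -> t \in `[0, pi].
Proof. by rewrite !in_itv/= => /andP[/ltW -> /ltW ->]. Qed.

Let abs_lt2 k (x : R) : x \in `[F (pi - eps k), F (eps k)] -> `|x| < 2.
Proof.
have /andP[e0 e1] := eps_bnd k.
rewrite in_itv/= /F cosB cospi sinpi => /andP[x1 x2].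
have : cos (eps k) < 1.
  rewrite -cos0 ltr_cos// ?in_itv/= ?lexx ?pi_ge0 ?ltW//=.
  by apply: lt_trans e1 _; rewrite ltrBlDr ltrDl.
by rewrite ltr_norml => ?; apply/andP; split; lra.
Qed.

Let sqrt_gt0 (x : R) : `|x| < 2 -> 0 < Num.sqrt (4 - x ^+ 2).
Proof.
by move=> x2; rewrite sqrtr_gt0; move: x2; rewrite ltr_norml => /andP[? ?]; nra.
Qed.

Let arcsine_continuous (g : R -> R) (x : R) : continuous g -> `|x| < 2 ->
  {for x, continuous (fun x => g x * (pi * Num.sqrt (4 - x ^+ 2))^-1)}.
Proof.
move=> cg x2; apply: cvgM; first exact: cg.
apply: cvgV; first by rewrite gt_eqF// mulr_gt0 ?pi_gt0 ?sqrt_gt0.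
apply: cvgM; first exact: cvg_cst.
apply: continuous_comp; last exact: sqrt_continuous.
apply: cvgB; first exact: cvg_cst.
exact: exprn_continuous.
Qed.

(** The density is the restriction to ]-2, 2[ of a function continuous there. *)
Lemma measurable_arcsine_density :
  measurable_fun [set: measurableTypeR R] (@arcsine_density R).
Proof.
have -> : @arcsine_density R =
    (fun x => 1 * (pi * Num.sqrt (4 - x ^+ 2))^-1) \_ [set` `](-2)%R, 2%R[].
  apply/funext => x; rewrite patchE /arcsine_density mul1r.
  by rewrite ltr_norml mem_setE in_itv.
apply: (iffLR (measurable_restrictT _ _)); first exact: measurable_itv.
apply: open_continuous_measurable_fun; first exact: interval_open.
move=> x; rewrite inE /= in_itv/= -ltr_norml => x2.
by apply: (arcsine_continuous _ x2) => y; exact: cvg_cst.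
Qed.

Let arcsine_substitution_eps k (g : R -> R) : continuous g ->
  (\int[mu]_(x in `[F (pi - eps k), F (eps k)]) (g x * arcsine_density x)%:E =
   \int[mu]_(t in `[eps k, (pi - eps k)%R]) (g (F t) * pi^-1)%:E)%E.
Proof.
move=> cg; have /andP[e0 e1] := eps_bnd k.
have sin0 t : t \in `[eps k, pi - eps k] -> 0 < sin t.
  by move=> /eps_itv; rewrite in_itv => /sin_gt0_pi.
have F'E : F^`()%classic = fun t => - (2 * sin t).
  by apply/funext => t; rewrite derive1E; apply: derive_val.
have cF' : continuous F^`()%classic.
  rewrite F'E => t; apply: cvgN; apply: cvgM; first exact: cvg_cst.
  exact: continuous_sin.
have dF t : derivable F t 1 by have /@ex_derive := is_derive_F t.
have cF : continuous F.
  by move=> t; apply/differentiable_continuous/derivable1_diffP.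
have decrF : {in `[eps k, pi - eps k] &, {homo F : x y /~ x < y}}.
  move=> x y /eps_itv x0 /eps_itv y0 xy; rewrite /F ltr_pM2l// ltr_cos//.
  - exact: itv_oo_cc.
  - exact: itv_oo_cc.
pose G x := g x * (pi * Num.sqrt (4 - x ^+ 2))^-1.
transitivity (\int[mu]_(x in `[F (pi - eps k), F (eps k)]) (G x)%:E)%E.
  apply: eq_integral => x; rewrite inE /= => /abs_lt2 x2.
  by rewrite /arcsine_density x2.
rewrite (@integration_by_substitution_decreasing R F G (eps k) (pi - eps k)).
- apply: eq_integral => t; rewrite inE /= => tI; congr EFin.
  rewrite F'E; change (G (F t) * - - (2 * sin t) = g (F t) * pi^-1).
  have st := sin0 t tI; rewrite /G.
  rewrite (_ : 4 - F t ^+ 2 = (2 * sin t) ^+ 2); last first.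
    by rewrite [RHS]exprMn sin2cos2 /F; ring.
  rewrite sqrtr_sqr gtr0_norm ?mulr_gt0//.
  by rewrite opprK invfM -mulrA divfK// gt_eqF// mulr_gt0.
- exact: ltW.
- exact: decrF.
- by move=> t _; exact: cF'.
- by apply: cvgP; apply: cvg_at_right_filter; exact: cF'.
- by apply: cvgP; apply: cvg_at_left_filter; exact: cF'.
- split; first by move=> t _; exact: dF.
  + by apply: cvg_at_right_filter; exact: cF.
  + by apply: cvg_at_left_filter; exact: cF.
- apply: continuous_in_subspaceT => x; rewrite inE /= => /abs_lt2 x2.
  exact: arcsine_continuous.
Qed.

Let ge0_arcsine_substitution (g : R -> R) : continuous g -> (forall x, 0 <= g x) ->
  (\int[mu]_x (g x * arcsine_density x)%:E =
   \int[mu]_(t in `[0%R, pi]) (g (2 * cos t) * pi^-1)%:E)%E.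
Proof.
move=> cg g0.
have mg : measurable_fun [set: measurableTypeR R] g.
  exact: continuous_measurable_fun.
have -> : (\int[mu]_x (g x * arcsine_density x)%:E =
    \int[mu]_(x in `](-2)%R, 2%R[) (g x * arcsine_density x)%:E)%E.
  rewrite [RHS]integral_mkcond; apply: eq_integral => x _; rewrite patchE.
  case: ifPn => //; rewrite notin_setE /= in_itv/= -ltr_norml => /negP x2.
  by rewrite /arcsine_density (negbTE x2) mulr0.
have -> : `]-2, 2[%classic =
    \bigcup_k `[F (pi - eps k), F (eps k)]%classic :> set R.
  apply/seteqP; split => x /=; last first.
    by move=> [k _ /abs_lt2]; rewrite in_itv/= ltr_norml.
  rewrite in_itv/= => /andP[x1 x2].
  have x2I : -1 <= x / 2 <= 1 by apply/andP; split; lra.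
  have aI : acos (x / 2) \in `]0, pi[.
    by rewrite in_itv/= acos_gt0 ?acos_ltpi//; apply/andP; split; lra.
  have [k tk] := eps_exists aI.
  have xE : x = F (acos (x / 2)).
    by rewrite /F acosK ?in_itv// mulrCA divff ?mulr1.
  exists k => //=; rewrite xE; have := tk; rewrite !in_itv/= => /andP[t0 t1].
  have /andP[e0 e1] := eps_bnd k.
  have tI := itv_oo_cc (eps_itv tk).
  have eI : eps k \in `[0, pi].
    by apply: itv_oo_cc; apply: (@eps_itv k); rewrite in_itv/= lexx ltW.
  have eI' : pi - eps k \in `[0, pi].
    by apply: itv_oo_cc; apply: (@eps_itv k); rewrite in_itv/= lexx ltW.
  by rewrite /F !ler_pM2l// !(leNgt (cos _)) !ltr_cos// -!leNgt t1 t0.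
have iU : `]0, pi[%classic = \bigcup_k `[eps k, pi - eps k]%classic :> set R.
  apply/seteqP; split => t /=; last by move=> [k _ /eps_itv].
  by move=> /eps_exists[k tk]; exists k.
have mgF : measurable_fun [set: measurableTypeR R]
    (fun t => (g (2 * cos t) * pi^-1)%:E).
  apply/measurable_EFinP; apply: measurable_funM => //.
  apply: measurableT_comp => //; apply: measurable_funM => //.
  by apply: continuous_measurable_fun; exact: continuous_cos.
rewrite integral_itv_bndoo; last exact: measurable_funTS.
rewrite iU.
have ndT : nondecreasing_seq (fun k => `[eps k, pi - eps k]%classic : set R).
  move=> m n mn; apply/subsetPset => t /=; rewrite !in_itv/= => /andP[t0 t1].
  by rewrite (le_trans (eps_le mn) t0) (le_trans t1)// lerD2l lerN2 eps_le.
have ndD : nondecreasing_seq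
    (fun k => `[F (pi - eps k), F (eps k)]%classic : set R).
  have cosle m n : (m <= n)%N -> cos (eps m) <= cos (eps n).
    have eI i : eps i \in `[0, pi].
      have /andP[e0 /ltW e1] := eps_bnd i.
      by apply: itv_oo_cc; apply: (@eps_itv i); rewrite in_itv/= lexx.
    by move=> mn; rewrite leNgt ltr_cos// -leNgt eps_le.
  move=> m n mn; apply/subsetPset => t /=.
  rewrite !in_itv/= /F !cosB cospi sinpi => /andP[t0 t1].
  by have emn := cosle _ _ mn; apply/andP; split; lra.
have mga : measurable_fun [set: measurableTypeR R]
    (fun x => (g x * arcsine_density x)%:E).
  apply/measurable_EFinP; apply: measurable_funM => //.
  exact: measurable_arcsine_density.
have l1 := @ge0_nondecreasing_set_cvg_integral _ (measurableTypeR R) R _ _ mu ndD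
  (fun k => measurable_itv _) (fun k => measurable_funTS mga)
  (fun k x _ => mulr_ge0 (g0 x) (arcsine_density_ge0 x)).
have pi_ge0 : 0 <= pi^-1 :> R by rewrite invr_ge0 pi_ge0.
have l2 := @ge0_nondecreasing_set_cvg_integral _ (measurableTypeR R) R _ _ mu ndT
  (fun k => measurable_itv _) (fun k => measurable_funTS mgF)
  (fun k x _ => mulr_ge0 (g0 (2 * cos x)) pi_ge0).
apply: (cvg_unique _ l1); first exact: ereal_hausdorff.
by move: l2; under eq_fun do rewrite -arcsine_substitution_eps//.
Qed.

(** The arcsine law is the law of 2 cos t for t uniform on [0, pi]: the Jacobian
    2 sin t of x = 2 cos t cancels sqrt (4 - x ^ 2). *)
Lemma arcsine_substitution (g : R -> R) : continuous g ->
  (\int[mu]_x (g x * arcsine_density x)%:E =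
   \int[mu]_(t in `[0%R, pi]) (g (2 * cos t) * pi^-1)%:E)%E.
Proof.
move=> cg; apply: (@eq_integral_continuous R setT `[0, pi] arcsine_density
  (cst pi^-1) (fun t => 2 * cos t)) => //.
- exact: arcsine_density_ge0.
- by move=> x; rewrite invr_ge0 pi_ge0.
Qed.

End arcsine_law.

(** * Matrix coefficients and their limits *)

Section scaled_moments.
Context {R : realType}.
Local Notation h := (@hermite_poly R).
Local Notation mu := (@lebesgue_measure R).
Implicit Types (p : {poly R}) (s : int).

(** The absolute value only makes the index a natural number: n + s is
    nonnegative for all large n, and only these matter in the limit.  The power
    of sqrt n replaces the factor sqrt (n! / (n + s)!) that would normalize the
    Hermite polynomials, to which it is asymptotic. *)
Definition scaled_coef (n : nat) p s : R :=
  Num.sqrt n%:R ^ (- s) / n`!%:R *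
  gaussE ((p \Po ((Num.sqrt n%:R)^-1 *: 'X)) * (h n * h (absz (n%:Z + s)))).

Lemma scaled_coefD n p q s :
  scaled_coef n (p + q) s = scaled_coef n p s + scaled_coef n q s.
Proof. by rewrite /scaled_coef comp_polyD mulrDl gaussED mulrDr. Qed.

Lemma scaled_coefC n c s : scaled_coef n c%:P s =
  c * (Num.sqrt n%:R ^ (- s) *+ (n == absz (n%:Z + s))).
Proof.
rewrite /scaled_coef comp_polyC mul_polyC gaussEZ hermite_poly_orthogonal.
rewrite -mulr_natr -[in RHS]mulr_natr; field.
by rewrite pnatr_eq0 -lt0n fact_gt0.
Qed.

(** X He_j = He_(j+1) + j He_(j-1) with j = n + s; the hypothesis on s keeps
    the index j - 1 meaningful. *)
Lemma scaled_coefMX n p s : (0 < n)%N -> 0 < n%:Z + s ->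
  scaled_coef n (p * 'X) s =
  scaled_coef n p (s + 1) + (n%:Z + s)%:~R / n%:R * scaled_coef n p (s - 1).
Proof.
move=> n0 ns.
have [j jE] : exists j : nat, n%:Z + s = j.+1%:Z.
  case: (n%:Z + s) ns => [[|j]|j] //.
  by exists j.
rewrite /scaled_coef !addrA jE.
have -> : absz (j.+1%:Z + 1) = j.+2 by rewrite -PoszD addn1.
have -> : absz (j.+1%:Z - 1) = j by rewrite -addn1 PoszD addrK.
rewrite comp_polyM comp_polyX; set P := p \Po _; set r := Num.sqrt _.
have r0 : r != 0 by rewrite gt_eqF// sqrtr_gt0 ltr0n.
have nr : n%:R = r ^+ 2 by rewrite sqr_sqrtr.
rewrite (_ : P * _ * _ =
  r^-1 *: (P * (h n * h j.+2) + (P * (h n * h j)) *+ j.+1)); last first.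
  have := @mulX_hermite_poly R j.+1; rewrite [j.+1.-1]/= => E.
  rewrite -scalerAr -scalerAl; congr (_ *: _).
  rewrite -mulrA (mulrC (h n)) (mulrA 'X) E; ring.
rewrite gaussEZ gaussED gaussEMn nr.
set E1 := gaussE _; set E2 := gaussE _.
rewrite !opprD opprK !expfzDr// !expr1z exprN1 -pmulrn.
have F0 : n`!%:R != 0 :> R by rewrite pnatr_eq0 -lt0n fact_gt0.
set q := r ^ (- s); rewrite -mulr_natr; field.
by rewrite F0 r0.
Qed.

(** The value of the limit of [scaled_coef n p s]: the s-th Fourier cosine
    coefficient of p (2 cos t). *)
Definition arcsine_coef p s : R :=
  \int[mu]_(t in `[0, pi]) (p.[2 * cos t] * cos (s%:~R * t) * pi^-1).

Lemma continuous_cosM s : continuous (fun t : R => cos (s%:~R * t)).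
Proof.
move=> t; apply: (@continuous_comp R R R (fun t : R => s%:~R * t) (@cos R));
  last exact: continuous_cos.
by apply: cvgM; [exact: cvg_cst|exact: cvg_id].
Qed.

Lemma continuous_horner_cos p : continuous (fun t : R => p.[2 * cos t]).
Proof.
move=> t; apply: (@continuous_comp R R R (fun t : R => 2 * cos t) (horner p));
  last exact: continuous_horner.
by apply: cvgM; [exact: cvg_cst|exact: continuous_cos].
Qed.

Lemma integrable_arcsine_coef p s :
  mu.-integrable `[0, pi] (fun t => (p.[2 * cos t] * cos (s%:~R * t) * pi^-1)%:E).
Proof.
apply: continuous_compact_integrable; first exact: segment_compact.
apply: continuous_subspaceT => t; apply: cvgM; last exact: cvg_cst.
by apply: cvgM; [exact: continuous_horner_cos|exact: continuous_cosM].
Qed.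

Lemma Rintegral_cos s :
  \int[mu]_(t in `[0, pi]) cos (s%:~R * t) = pi *+ (s == 0).
Proof.
have [->|s0] := eqVneq s 0.
  under eq_Rintegral do rewrite mul0r cos0.
  have mu_pi : mu `[0, pi]%classic = pi%:E.
    by rewrite lebesgue_measure_itv/= lte_fin pi_gt0 sube0.
  by rewrite Rintegral_cst// mul1r; exact: (congr1 fine mu_pi).
have s0' : s%:~R != 0 :> R by rewrite intr_eq0.
have sin_s : sin (s%:~R * pi) = 0 :> R.
  suff sin_n (m : nat) : sin (m%:R * pi) = 0 :> R.
    case: s {s0 s0'} => m; first exact: sin_n.
    by rewrite NegzE mulrNz mulNr sinN sin_n oppr0.
  by rewrite mulr_natl -[_ *+ _]add0r alternatingn ?sin0 ?mulr0//; exact: sinDpi.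
pose f t : R := cos (s%:~R * t); pose F t : R := (s%:~R)^-1 * sin (s%:~R * t).
have dF (t : R) : is_derive t 1 F (f t).
  apply: trigger_derive; rewrite /GRing.scale /= mulr1 mulrCA mulrA.
  by rewrite divfK.
have derF t : derivable F t 1 by have /@ex_derive := dF t.
have cF : continuous F.
  by move=> t; apply/differentiable_continuous/derivable1_diffP.
rewrite /Rintegral (@continuous_FTC2 _ f F).
- by rewrite /F sin_s !mulr0 sin0 mulr0 subee.
- exact: pi_gt0.
- by apply: continuous_subspaceT => t; exact: continuous_cosM.
- split; first by move=> t _; exact: derF.
  + by apply: cvg_at_right_filter; exact: cF.
  + by apply: cvg_at_left_filter; exact: cF.
- by move=> t _; rewrite derive1E; have /@derive_val := dF t.
Qed.

Lemma arcsine_coefC c s : arcsine_coef c%:P s = c *+ (s == 0).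
Proof.
rewrite /arcsine_coef.
under eq_Rintegral do rewrite hornerC mulrAC.
rewrite RintegralZl//.
  by rewrite Rintegral_cos mulrnAr divfK// gt_eqF// pi_gt0.
apply: continuous_compact_integrable; first exact: segment_compact.
by apply: continuous_subspaceT; exact: continuous_cosM.
Qed.

Lemma arcsine_coefD p q s :
  arcsine_coef (p + q) s = arcsine_coef p s + arcsine_coef q s.
Proof.
rewrite /arcsine_coef -RintegralD//; [|exact: integrable_arcsine_coef..].
by apply: eq_Rintegral => t _; rewrite hornerD; ring.
Qed.

(** 2 cos t cos (s t) = cos ((s + 1) t) + cos ((s - 1) t). *)
Lemma arcsine_coefMX p s :
  arcsine_coef (p * 'X) s = arcsine_coef p (s + 1) + arcsine_coef p (s - 1).
Proof.
rewrite /arcsine_coef -RintegralD//; [|exact: integrable_arcsine_coef..].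
apply: eq_Rintegral => t _; rewrite hornerMX.
have -> : (s + 1)%:~R * t = s%:~R * t + t by rewrite intrD mulrDl mul1r.
have -> : (s - 1)%:~R * t = s%:~R * t - t by rewrite intrB mulrBl mul1r.
by rewrite cosD cosB; ring.
Qed.

(** Both sides are linear in p, have the same value on constants for large n,
    and satisfy recursions for multiplication by X whose weights 1 and
    (n + s) / n agree in the limit. *)
Lemma scaled_coef_cvg p s : scaled_coef n p s @[n --> \oo] --> arcsine_coef p s.
Proof.
elim/poly_ind: p s => [|p c IH] s.
  rewrite -[0]/(0%:P) arcsine_coefC mul0rn.
  by under eq_fun do rewrite scaled_coefC mul0r; exact: cvg_cst.
rewrite arcsine_coefD arcsine_coefMX.
under eq_fun do rewrite scaled_coefD.
have n_gt0 : \forall n \near \oo, (0 < n)%N by exact: nbhs_infty_gt.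
have ns_gt0 : \forall n \near \oo, 0 < n%:Z + s.
  by exists (absz s).+1 => // n /= sn; lia.
apply: cvgD.
  have l : (n%:Z + s)%:~R / n%:R @[n --> \oo] --> (1 : R).
    have cvg_invr_nat : n%:R^-1 @[n --> \oo] --> (0 : R).
      by rewrite -cvg_shiftS; exact: cvg_harmonic.
    have l : 1 + s%:~R * n%:R^-1 @[n --> \oo] --> (1 + s%:~R * 0 : R).
      apply: cvgD; first exact: cvg_cst.
      by apply: cvgM; [exact: cvg_cst|exact: cvg_invr_nat].
    rewrite mulr0 addr0 in l; apply: cvg_trans l; apply: near_eq_cvg.
    near=> n; rewrite /= intrD mulrDl -pmulrn divff// pnatr_eq0 -lt0n.
    by near: n; exact: nbhs_infty_gt.
  have l' : scaled_coef n p (s + 1) +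
      (n%:Z + s)%:~R / n%:R * scaled_coef n p (s - 1)
      @[n --> \oo] --> arcsine_coef p (s + 1) + 1 * arcsine_coef p (s - 1).
    by apply: cvgD; [exact: IH|apply: cvgM; [exact: l|exact: IH]].
  rewrite mul1r in l'; apply: cvg_trans l'; apply: near_eq_cvg.
  by near=> n; apply/esym; apply: scaled_coefMX; near: n.
rewrite arcsine_coefC.
apply: cvg_near_cst; near=> n; rewrite scaled_coefC.
have ns : 0 < n%:Z + s by near: n.
have -> : (n == absz (n%:Z + s)) = (s == 0) by lia.
by have [->|_] := eqVneq s 0; rewrite ?oppr0 ?expr0z ?mulr1// mulr0n mulr0.
Unshelve. all: by end_near.
Qed.

End scaled_moments.

(** * The oscillator densities *)

Section conclusion.
Context {R : realType}.
Local Notation mu := (@lebesgue_measure R).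
Local Notation phi := (normal_pdf (0 : R) 1).
Local Notation h := (@hermite_poly R).
Implicit Types p : {poly R}.

Lemma oscillator_density_ge0 n (x : R) : 0 <= oscillator_density n x.
Proof. by rewrite mulr_ge0 ?sqr_ge0. Qed.

Lemma oscillator_sqr n (x : R) :
  oscillator n x ^+ 2 = (n`!%:R^-1 *: h n ^+ 2).[x] * phi x.
Proof.
rewrite /oscillator hermiteE normal_pdf01E 2!exprMn exprVn !sqr_sqrtr//.
by rewrite hornerZ horner_exp.
Qed.

Definition oscillator_poly n p : {poly R} :=
  n`!%:R^-1 *: ((p \Po ((Num.sqrt n%:R)^-1 *: 'X)) * h n ^+ 2).

(** The substitution y = sqrt n x. *)
Lemma oscillator_integral n p : (0 < n)%N ->
  (\int[mu]_x (p.[x] * oscillator_density n x)%:E =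
   (gaussE (oscillator_poly n p))%:E)%E.
Proof.
move=> n0; set r : R := Num.sqrt n%:R.
have r0 : 0 < r by rewrite sqrtr_gt0 ltr0n.
pose G y := (oscillator_poly n p).[y] * phi y.
have -> : (\int[mu]_x (p.[x] * oscillator_density n x)%:E =
    \int[mu]_x (G (r * x) * r)%:E)%E.
  apply: eq_integral => x _; congr EFin.
  rewrite /oscillator_density -/r oscillator_sqr /G /oscillator_poly -/r.
  rewrite !hornerZ !horner_exp hornerM horner_exp horner_comp hornerZ hornerX.
  by rewrite mulKf ?gt_eqF//; ring.
rewrite integral_scale//.
  rewrite /gaussE gauss_Rintegral /Rintegral fineK//.
  exact: integrable_fin_num (integrable_poly_gauss _).
move=> x; apply: cvgM; first exact: continuous_horner.
by apply: continuous_normal_pdf; rewrite oner_eq0.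
Qed.

Lemma measurable_oscillator_density n :
  measurable_fun [set: measurableTypeR R] (@oscillator_density R n).
Proof.
pose r : R := Num.sqrt n%:R.
have -> : @oscillator_density R n =
    (fun x => r * ((n`!%:R^-1 *: h n ^+ 2).[r * x] * phi (r * x))).
  by apply/funext => x; rewrite /oscillator_density oscillator_sqr.
apply: measurable_funM => //; apply: (measurableT_comp (measurable_poly_gauss _)).
exact: measurable_funM.
Qed.

Lemma oscillator_is_pdf n : (0 < n)%N -> is_pdf (@oscillator_density R n).
Proof.
move=> n0; split; first exact: measurable_oscillator_density.
  exact: oscillator_density_ge0.
have := oscillator_integral 1 n0.
rewrite /oscillator_poly comp_polyC mul1r gaussEZ expr2.
rewrite hermite_poly_orthogonal eqxx mulVf ?pnatr_eq0 -?lt0n ?fact_gt0// => <-.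
by apply: eq_integral => x _; rewrite hornerC mul1r.
Qed.

Lemma arcsine_poly_integral p :
  (\int[mu]_x (p.[x] * arcsine_density x)%:E = (arcsine_coef p 0)%:E)%E.
Proof.
rewrite (arcsine_substitution (@continuous_horner R p)).
rewrite /arcsine_coef /Rintegral fineK.
  by apply: eq_integral => t _; rewrite mul0r cos0 mulr1.
exact: integrable_fin_num (integrable_arcsine_coef p 0).
Qed.

Lemma arcsine_is_pdf : is_pdf (@arcsine_density R).
Proof.
split; [exact: measurable_arcsine_density|exact: arcsine_density_ge0|].
have := arcsine_poly_integral 1; rewrite (arcsine_coefC 1 0) mulr1n => <-.
by apply: eq_integral => x _; rewrite hornerC mul1r.
Qed.

Lemma pdf_probE f (pf : is_pdf f) p :
  \int[pdf_prob pf]_x p.[x] = fine (\int[mu]_x (p.[x] * f x)%:E)%E.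
Proof.
have [mf f0 _] := pf.
rewrite /Rintegral (@integral_density R (pdf_prob pf) f)//.
by apply: continuous_measurable_fun; exact: continuous_horner.
Qed.

(** Since |p| <= 1 + p ^ 2, finite integrals of polynomials bound those of their
    absolute values. *)
Lemma poly_integrable_pdf f (pf : is_pdf f) :
  (forall p, (\int[mu]_x (p.[x] * f x)%:E < +oo)%E) ->
  poly_integrable (pdf_prob pf).
Proof.
have [mf f0 _] := pf; move=> fin_f p.
have mp q : measurable_fun [set: measurableTypeR R] (horner q).
  by apply: continuous_measurable_fun; exact: continuous_horner.
apply: (@integrable_density R (pdf_prob pf) f) => //.
apply/integrableP; split; first by apply/measurable_EFinP; exact: measurable_funM.
apply: le_lt_trans (fin_f (1%:P + p ^+ 2)); apply: ge0_le_integral => //.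
- by apply/measurableT_comp => //; apply/measurable_EFinP; exact: measurable_funM.
- by apply/measurable_EFinP; exact: measurable_funM.
- move=> x _; rewrite /= lee_fin normrM (ger0_norm (f0 x)) ler_wpM2r//.
  rewrite hornerD hornerC horner_exp -(real_normK (num_real p.[x])).
  by have := sqr_ge0 (`|p.[x]| - 2^-1); rewrite sqrrB; lra.
Qed.

Lemma oscillator_weak_cvg
    (osc_pdf : forall n : nat, is_pdf (@oscillator_density R n.+1))
    (arcsine_pdf : is_pdf (@arcsine_density R)) :
  weak_cvg (fun n : nat => pdf_prob (osc_pdf n)) (pdf_prob arcsine_pdf).
Proof.
apply: (@weak_cvg_moments R _ _ 2) => //.
- move=> n; apply: poly_integrable_pdf => p.
  by rewrite oscillator_integral// ltry.
- by apply: poly_integrable_pdf => p; rewrite arcsine_poly_integral ltry.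
- move=> p; rewrite pdf_probE arcsine_poly_integral /=.
  under eq_fun do rewrite pdf_probE oscillator_integral//=.
  rewrite (_ : (fun n => _) = (fun n => scaled_coef n.+1 p 0)).
    by have := @scaled_coef_cvg R p 0; rewrite -cvg_shiftS.
  apply/funext => n; rewrite /scaled_coef /oscillator_poly gaussEZ.
  by rewrite oppr0 expr0z mul1r addr0 expr2.
(* The even moments of the arcsine law are bounded by those of its endpoint 2. *)
- move=> m; rewrite pdf_probE arcsine_poly_integral /=.
  apply: (@le_trans _ _ (arcsine_coef (2 ^+ m.*2)%:P 0)); last first.
    by rewrite arcsine_coefC mulr1n.
  apply: le_Rintegral => //; [exact: integrable_arcsine_coef..|].
  move=> t _; rewrite mul0r cos0 !mulr1 ler_wpM2r ?invr_ge0 ?pi_ge0//.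
  rewrite hornerXn hornerC -norm_expr_double normrM ger0_norm//.
  by rewrite exprMn ler_piMr ?exprn_ge0// exprn_ile1// cos_max.
Qed.

End conclusion.

(* The sequence starts at n = 1: for n = 0 the function
   x |-> sqrt n * oscillator n (sqrt n * x) ^+ 2 vanishes identically. *)
Theorem proposition4p7 (R : realType) :
  exists (osc_pdf : forall n : nat, is_pdf (@oscillator_density R n.+1))
         (arcsine_pdf : is_pdf (@arcsine_density R)),
    weak_cvg (fun n : nat => pdf_prob (osc_pdf n)) (pdf_prob arcsine_pdf).
Proof.
exists (fun n => @oscillator_is_pdf R n.+1 isT), arcsine_is_pdf.
exact: oscillator_weak_cvg.
Qed.
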